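(* Let $\ell$ be a positive integer and let $\mathcal{X}$ be a $\mathbb{Z}$-scheme of $\mathbb{F}_{1^\ell}$-type with counting polynomial $N_{\mathcal{X}}(Y) = \sum_{k=0}^n a_k Y^k \in \mathbb{Z}[Y]$. Then, for $s \in \mathbb{C}\setminus\{0,1,\ldots,n\}$, $$\zeta_{\mathcal{X}\vert \mathbb{F}_{1^\ell}}(s) \;=\; \lim_{p \to 1} \zeta_{\mathcal{X}\vert \mathbb{F}_{p^\ell}}(s)\,(p-1)^{\vert \mathcal{X}_{\mathbb{F}_1}\vert},$$ where $p$ is seen as a complex variable.
   Context: A $\mathbb{Z}$-scheme $\mathcal{X}$ is of $\mathbb{F}_{1^\ell}$-type if there exists a polynomial $N_{\mathcal{X}}(Y) = \sum_{k=0}^n a_k Y^k \in \mathbb{Z}[Y]$ such that for all primes $p$ and all integers $m \geq 1$, the number of $\mathbb{F}_{p^{\ell m}}$-rational points satisfies $\vert \mathcal{X}_{\mathbb{F}_{p^{\ell m}}}\vert = N_{\mathcal{X}}(p^{\ell m})$. The $\mathbb{F}_{1^\ell}$-zeta function of such a scheme is defined as $$\zeta_{\mathcal{X}\vert \mathbb{F}_{1^\ell}}(s) := \prod_{k=0}^n (\ell(s-k))^{-a_k},$$ and $\vert \mathcal{X}_{\mathbb{F}_1}\vert := \sum_{k=0}^n a_k = N_{\mathcal{X}}(1)$. For a prime $p$, the local zeta function $\zeta_{\mathcal{X}\vert \mathbb{F}_{p^\ell}}(s) = \exp\bigl(\sum_{m\ge 1} \frac{\vert \mathcal{X}_{\mathbb{F}_{p^{\ell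 m}}}\vert}{m} p^{-\ell s m}\bigr)$ is given by the expression $\prod_{k=0}^n (1 - p^{\ell(k-s)})^{-a_k}$; in the limit, $\zeta_{\mathcal{X}\vert \mathbb{F}_{p^\ell}}(s)$ denotes this same expression $\prod_{k=0}^n (1 - p^{\ell(k-s)})^{-a_k}$ with $p$ a complex variable near (and different from) $1$, complex powers of $p$ being taken with the principal logarithm. *)

(* Defs.v *)
From HB Require Import structures.
From mathcomp Require Import all_boot all_order all_algebra.
From mathcomp Require Import all_classical all_reals all_analysis.
From mathcomp Require Import complex.
Set Implicit Arguments.
Unset Strict Implicit.
Unset Printing Implicit Defensive.
Import Order.TTheory GRing.Theory Num.Theory.
Import numFieldNormedType.Exports.
Local Open Scope classical_set_scope.
Local Open Scope ring_scope.

Record opens (T : topologicalType) := Opens {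
  oset :> set T;
  oset_open : open oset }.

Definition opensI (T : topologicalType) (U V : opens T) : opens T :=
  Opens (openI (oset_open U) (oset_open V)).

(* Rings are [comPzRingType]: the zero ring is allowed, as it must be, being
   the ring of sections over the empty set. *)
Record ringedSpace := RingedSpace {
  rs_pts :> topologicalType;
  sec : opens rs_pts -> comPzRingType;
  res : forall U V : opens rs_pts, V `<=` U -> {rmorphism sec U -> sec V};
  res_id : forall (U : opens rs_pts) (h : U `<=` U) (f : sec U), res h f = f;
  res_comp : forall (U V W : opens rs_pts) (hVU : V `<=` U) (hWV : W `<=` V)
      (hWU : W `<=` U) (f : sec U), res hWV (res hVU f) = res hWU f;
  sec_sheaf : forall (U : opens rs_pts) (I : Type) (V : I -> opens rs_pts)
      (hV : forall i, V i `<=` U) (f : forall i, sec (V i)),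
    U `<=` \bigcup_i V i ->
    (forall i j, res (V := opensI (V i) (V j)) (@subIsetl _ _ _) (f i)
               = res (V := opensI (V i) (V j)) (@subIsetr _ _ _) (f j)) ->
    exists! g : sec U, forall i, res (hV i) g = f i }.

Definition invertible (A : comPzRingType) (x : A) : Prop :=
  exists y, x * y = 1.

Section Spectrum.
Variable A : comPzRingType.

Record prime_ideal (P : set A) : Prop := PrimeIdeal {
  prime0 : P 0;
  primeD : forall x y, P x -> P y -> P (x + y);
  primeMl : forall a x, P x -> P (a * x);
  prime1 : ~ P 1;
  primeM : forall x y, P (x * y) -> P x \/ P y }.

Definition Spec : Type := {P : set A | prime_ideal P}.

HB.instance Definition _ := gen_eqMixin Spec.
HB.instance Definition _ := gen_choiceMixin Spec.

Definition Dset (f : A) : set Spec := [set P | ~ sval P f].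

Definition zariski_open (U : set Spec) : Prop :=
  exists E : set A, U = \bigcup_(f in E) Dset f.

Lemma zariski_openT : zariski_open setT.
Proof.
exists [set 1]; rewrite bigcup_set1; apply/seteqP; split=> // P _.
by case: P => P /= [].
Qed.

Lemma zariski_openI : setI_closed zariski_open.
Proof.
move=> _ _ [E ->] [F ->].
exists [set h | exists2 f, E f & exists2 g, F g & h = f * g].
apply/seteqP; split=> [P [[f Ef Pf] [g Fg Pg]]|P [_ [f Ef [g Fg ->]] Pfg]].
  exists (f * g); first by exists f => //; exists g.
  by case: P Pf Pg => P pP /= Pf Pg /= /(primeM pP)[].
by split; [exists f|exists g] => // Ph; apply: Pfg; case: P Ph => P pP /= Ph;
  [rewrite mulrC|]; exact: primeMl.
Qed.

Lemma zariski_open_bigU (I : Type) (U : I -> set Spec) :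
  (forall i, zariski_open (U i)) -> zariski_open (\bigcup_i U i).
Proof.
move=> /choice[E UE]; exists (\bigcup_i E i); rewrite bigcup_bigcup.
by apply: eq_bigcup => // i _; rewrite UE.
Qed.

HB.instance Definition _ := isOpenTopological.Build Spec
  zariski_openT zariski_openI zariski_open_bigU.

End Spectrum.

(* For a ring morphism [g]: the ring morphism induced by [g] from the localization A_f (fractions
   a / f ^ n) to [B] exists and is bijective. *)
Definition is_localization (A B : comPzRingType) (f : A) (g : A -> B) : Prop :=
  [/\ invertible (g f),
      forall b, exists a n, b * g f ^+ n = g a &
      forall a, g a = 0 -> exists n, f ^+ n * a = 0].

(* (U, O_X|U) is isomorphic to (Spec A, O_(Spec A)): [psi] is a homeomorphism
   from Spec A onto U and, through it, O_X|U becomes the sheaf of rings on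
   Spec A characterized by O(D(f)) = A_f, compatibly with restrictions (the
   latter since all identifications are as A-algebras via [alpha]). *)
Definition is_affine_open (X : ringedSpace) (U : opens X) : Prop :=
  exists (A : comPzRingType) (psi : Spec A -> X)
         (alpha : {rmorphism A -> sec U}),
    [/\ continuous psi, injective psi,
        forall W : set (Spec A), open W -> open (psi @` W),
        psi @` setT = U &
        forall (f : A) (V : opens X) (hVU : V `<=` U),
          V = psi @` Dset f :> set X ->
          is_localization f (res hVU \o alpha)].

(* Every scheme has a unique morphism to Spec Z, so schemes and Z-schemes
   are the same. The stalks are automatically local rings. *)
Record scheme := Scheme {
  scheme_rs :> ringedSpace;
  scheme_affine : forall x : scheme_rs,
    exists2 U : opens scheme_rs, oset U x & is_affine_open U }.

(* A morphism of locally ringed spaces Spec F -> X amounts to a point x of X with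
   a local morphism O_(X, x) -> F, given on germs: [rp_val U] sends a section
   over U to the image of its germ at x. *)
Record rational_point (X : scheme) (F : fieldType) := RationalPoint {
  rp_pt : X;
  rp_val : forall U : opens X, oset U rp_pt -> {rmorphism sec U -> F};
  rp_res : forall (U V : opens X) (hVU : V `<=` U)
      (Ux : oset U rp_pt) (Vx : oset V rp_pt) (f : sec U),
    rp_val Vx (res hVU f) = rp_val Ux f;
  rp_local : forall (U : opens X) (Ux : oset U rp_pt) (f : sec U),
    rp_val Ux f != 0 ->
    exists (V : opens X) (hVU : V `<=` U), oset V rp_pt /\ invertible (res hVU f) }.

Definition counting_polynomial (l : nat) (X : scheme) (N : {poly int}) : Prop :=
  forall (p m : nat) (F : finFieldType),
    prime p -> (0 < m)%N -> #|F| = (p ^ (l * m))%N ->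
    exists2 c : nat, ([set: rational_point X F] #= `I_c)%card
                   & c%:Z = N.[(p ^ (l * m))%N%:Z].

Section Zeta.
Local Open Scope complex_scope.
Variable R : realType.
Local Notation C := R[i].

(* R[i] does not inherit the norm topology of a numFieldType by itself. *)
HB.instance Definition _ := PseudoPointedMetric.copy C C^o.

Definition cexp (z : C) : C :=
  let: x +i* y := z in (expR x * cos y) +i* (expR x * sin y).

(* Principal argument, in ]-pi, pi]. *)
Definition carg (z : C) : R :=
  let: x +i* y := z in
  let t := acos (x / Num.sqrt (x ^+ 2 + y ^+ 2)) in
  if 0 <= y then t else - t.

Definition clog (z : C) : C :=
  let: x +i* y := z in ln (Num.sqrt (x ^+ 2 + y ^+ 2)) +i* carg z.

Definition cpow (z w : C) : C := cexp (w * clog z).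

Variables (l n : nat) (a : 'I_n.+1 -> int).

Definition zeta_F1 (s : C) : C :=
  \prod_(k < n.+1) (l%:R * (s - k%:R)) ^ (- a k).

Definition card_F1 : int := \sum_(k < n.+1) a k.

(* For a prime [p] this is the local zeta function, i.e. the exponential of
   \sum_(m >= 1) N(p ^ (l m)) / m * p ^ (- l s m); here [p] is complex. *)
Definition zeta_Fp (p s : C) : C :=
  \prod_(k < n.+1) (1 - cpow p (l%:R * (k%:R - s))) ^ (- a k).

End Zeta.

(* Main.v *)
(** Since [card_F1] is the sum of the [a k], the expression under the limit is
    the product of the factors [((1 - p ^ w k) / (p - 1)) ^ (- a k)] where
    [w k = l (k - s)], so it suffices that [(p ^ w - 1) / (p - 1)] tends to [w].
    With [L = log p], which tends to 0 as [p] tends to 1, this quotient is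
    [(exp (w L) - 1) / (exp L - 1)], because [exp (log p) = p]; the claim thus
    reduces to [(exp h - 1) / h --> 1] as the complex number [h] tends to 0. *)
Require Import Defs.
From mathcomp Require Import all_boot all_order all_algebra.
From mathcomp Require Import all_classical all_reals all_analysis.
From mathcomp Require Import complex ring lra.
Set Implicit Arguments.
Unset Strict Implicit.
Unset Printing Implicit Defensive.
Import Order.TTheory GRing.Theory Num.Theory.
Import numFieldNormedType.Exports.
Local Open Scope classical_set_scope.
Local Open Scope ring_scope.

(** * Limits of products and quotients over a numeric field *)

Lemma cvg_prod_exprz (K : numFieldType) (T : Type) (F : set_system T)
    {FF : Filter F} (n : nat) (f : 'I_n -> T -> K) (c : 'I_n -> K)
    (z : 'I_n -> int) :
  (forall k, c k != 0) -> (forall k, f k x @[x --> F] --> c k) ->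
  \prod_(k < n) f k x ^ z k @[x --> F] --> \prod_(k < n) c k ^ z k.
Proof.
move=> c0 fc.
apply: cvg_big => [x|k _]; first exact: mul_continuous.
have fX m : f k x ^+ m @[x --> F] --> c k ^+ m.
  elim: m => [|m IHm]; first exact: cvg_cst.
  by rewrite exprS; under eq_fun do rewrite exprS; exact: cvgM.
(* A negative exponent gives the inverse of a positive power, whose limit is nonzero because [c k]
   is. *)
by case: (z k) => m; [exact: fX|apply: cvgV; [exact: expf_neq0|exact: fX]].
Qed.

Lemma cvg_mul0 (K : numFieldType) (T : Type) (F : set_system T)
    {FF : Filter F} (w : K) (f : T -> K) :
  f x @[x --> F] --> (0 : K) -> w * f x @[x --> F] --> (0 : K).
Proof.
move=> f0; rewrite -[X in _ --> X](mulr0 w); apply: cvgM => //.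
exact: cvg_cst.
Qed.

Lemma cvg_mul_ratio1 (K : numFieldType) (T : Type) (F : set_system T)
    {FF : Filter F} (w : K) (f g : T -> K) :
  f x @[x --> F] --> (1 : K) -> g x @[x --> F] --> (1 : K) ->
  w * (f x / g x) @[x --> F] --> w.
Proof.
move=> f1 g1; rewrite -[X in _ --> X]mulr1; apply: cvgM; first exact: cvg_cst.
rewrite -[X in _ --> X]divr1; apply: cvgM => //.
by apply: cvgV => //; exact: oner_neq0.
Qed.

(** * Convergence in [R[i]] through real and imaginary parts *)

Section Complex.
Variable R : realType.
Local Notation C := R[i].
Local Notation Re := (@complex.Re R).
Local Notation Im := (@complex.Im R).

(** A positive element of [R[i]] has zero imaginary part, so the tolerances of the norm topology, a
    priori complex, can be taken in [R]. *)
Lemma cvgCP (T : Type) (F : set_system T) {FF : Filter F}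
    (f : T -> C) (c : C) :
  (f x @[x --> F] --> c) <->
  (forall e : R, 0 < e -> \forall x \near F, `|c - f x| <= e%:C%C).
Proof.
split=> [fc e e0|h].
  have /cvgrPdist_le := (fc : (f : T -> C^o) x @[x --> F] --> (c : C^o)).
  by apply; rewrite ltcR.
suff : (f : T -> C^o) x @[x --> F] --> (c : C^o) by [].
apply/cvgrPdist_le => e; rewrite ltcE /= => /andP[/eqP e1 e0].
by move: (h _ e0); congr (F _); apply/funext => x; case: e e1 {e0} => a b /= ->.
Qed.

Lemma ReB (x y : C) : Re (x - y) = Re x - Re y.
Proof. by case: x y => [? ?] []. Qed.

Lemma ImB (x y : C) : Im (x - y) = Im x - Im y.
Proof. by case: x y => [? ?] []. Qed.

Lemma normCi : `|'i%C : C| = 1.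
Proof. by rewrite normc_def/= expr0n expr1n add0r sqrtr1. Qed.

Lemma norm_le_ReIm (z : C) (e : R) :
  `|Re z| <= e -> `|Im z| <= e -> `|z| <= (e + e)%:C%C.
Proof.
move=> hR hI; rewrite [z in `|z|]complexE (le_trans (ler_normD _ _))//.
rewrite rmorphD/= normrM normCi mul1r !normc_def/= expr0n/= !addr0 !sqrtr_sqr.
by rewrite lerD// lecR.
Qed.

Lemma norm_ge_Re (z : C) (e : R) : `|z| <= e%:C%C -> `|Re z| <= e.
Proof. by move=> h; rewrite -lecR; exact: le_trans (normc_ge_Re _) h. Qed.

(** Multiplication by ['i] preserves the norm and turns [Im z] into a real part, up to sign. *)
Lemma norm_ge_Im (z : C) (e : R) : `|z| <= e%:C%C -> `|Im z| <= e.
Proof.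
by move=> h; rewrite -normrN -ReiNIm norm_ge_Re// normrM normCi mulr1.
Qed.

Lemma is_derive0_littleo (f : R -> R) (d : R) : is_derive (0 : R) (1 : R) f d ->
  forall e, 0 < e -> \forall h \near 0, `|f h - f 0 - d * h| <= e * `|h|.
Proof.
move=> [df dfE] e e0; have /eqaddoP := derivable_nbhs df.
move=> /(_ e e0); rewrite dfE; apply: filterS => h /=.
rewrite !fctE /= /cst [h%:A]mulr1 addr0 -[h *: d]/(h * d).
by rewrite opprD addrA (mulrC h).
Qed.

Lemma cvg_Re (T : Type) (F : set_system T) {FF : Filter F}
    (f : T -> C) (c : C) :
  f x @[x --> F] --> c -> Re (f x) @[x --> F] --> Re c.
Proof.
move=> /cvgCP fc; apply/cvgrPdist_le => e e0.
apply: filterS (fc e e0) => x /norm_ge_Re.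
by rewrite ReB.
Qed.

Lemma cvg_Im (T : Type) (F : set_system T) {FF : Filter F}
    (f : T -> C) (c : C) :
  f x @[x --> F] --> c -> Im (f x) @[x --> F] --> Im c.
Proof.
move=> /cvgCP fc; apply/cvgrPdist_le => e e0.
apply: filterS (fc e e0) => x /norm_ge_Im.
by rewrite ImB.
Qed.

Lemma cvgC_ReIm (T : Type) (F : set_system T) {FF : Filter F}
    (f : T -> C) (c : C) :
  Re (f x) @[x --> F] --> Re c -> Im (f x) @[x --> F] --> Im c ->
  f x @[x --> F] --> c.
Proof.
move=> /cvgrPdist_le hR /cvgrPdist_le hI; apply/cvgCP => e e0.
have e20 : 0 < e / 2 by rewrite divr_gt0.
near=> x; rewrite [e]splitr norm_le_ReIm//.
  by rewrite ReB; near: x; exact: hR.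
by rewrite ImB; near: x; exact: hI.
Unshelve. all: by end_near. Qed.

(** * First-order expansion of the complex exponential at 0 *)

(** The real part is [(expR x - 1 - x) + expR x * (cos y - 1)] and the imaginary part is
    [expR x * (sin y - y) + (expR x - 1) * y]. Since [expR x] is at most 2 and [|expR x - 1|] at
    most [d], each is at most [3 * d] times the norm. *)
Lemma cexp_sub_le (d x y : R) : d <= 1 -> `|x| <= d / 2 ->
  `|expR x - 1 - x| <= d * `|x| -> `|cos y - 1| <= d * `|y| ->
  `|sin y - y| <= d * `|y| ->
  `|cexp (x +i* y)%C - 1 - (x +i* y)%C| <= (6 * d)%:C%C * `|(x +i* y)%C|.
Proof.
move=> d1 xd hE hC hS; rewrite [`|(x +i* y)%C|]normc_def -rmorphM/=.
(* Taking the norm [N] itself as the bound yields [|x| <= N] and [|y| <= N]. *)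
have := @norm_ge_Re (x +i* y)%C (Num.sqrt (x ^+ 2 + y ^+ 2)).
have := @norm_ge_Im (x +i* y)%C (Num.sqrt (x ^+ 2 + y ^+ 2)).
rewrite normc_def lexx => /(_ isT) + /(_ isT).
set N := Num.sqrt _ => /= yN xN.
have N0 : 0 <= N by rewrite sqrtr_ge0.
have d0 : 0 <= d by have := normr_ge0 x; lra.
have dx : d * `|x| <= `|x| by rewrite ler_piMl.
have E1 : `|expR x - 1| <= d.
  rewrite (_ : _ - 1 = (expR x - 1 - x) + x); last by ring.
  by rewrite (le_trans (ler_normD _ _))//; lra.
have E2 : `|expR x| <= 2.
  rewrite (_ : expR x = (expR x - 1) + 1); last by ring.
  by rewrite (le_trans (ler_normD _ _))// normr1; lra.
have dxN : d * `|x| <= d * N by rewrite ler_wpM2l.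
have dyN : d * `|y| <= d * N by rewrite ler_wpM2l.
rewrite (_ : 6 * d * N = 3 * (d * N) + 3 * (d * N)); last by ring.
apply: norm_le_ReIm => /=.
  rewrite (_ : _ - _ = (expR x - 1 - x) + expR x * (cos y - 1)); last by ring.
  rewrite (le_trans (ler_normD _ _))// normrM.
  have : `|expR x| * `|cos y - 1| <= 2 * (d * N) by rewrite ler_pM//; lra.
  lra.
rewrite (_ : _ - _ = expR x * (sin y - y) + (expR x - 1) * y); last by ring.
rewrite (le_trans (ler_normD _ _))// !normrM.
have : `|expR x| * `|sin y - y| <= 2 * (d * N) by rewrite ler_pM//; lra.
have : `|expR x - 1| * `|y| <= d * N by rewrite ler_pM//; lra.
lra.
Qed.

Lemma cexp_sub_littleo (e : R) : 0 < e ->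
  \forall h \near (0 : C), `|cexp h - 1 - h| <= e%:C%C * `|h|.
Proof.
(* The 6 is the constant of [cexp_sub_le], and the cap 1 meets its condition [d <= 1]. *)
move=> e0; pose d := Num.min (e / 6) 1.
have d0 : 0 < d by rewrite lt_min divr_gt0/=.
have de : 6 * d <= e by rewrite mulrC -ler_pdivlMr// ge_min lexx.
have d1 : d <= 1 by rewrite ge_min lexx orbT.
(* A limit is an inclusion of filters: [Re0] and [Im0] carry properties valid near the real 0 over
   to [Re h] and [Im h] for [h] near the complex 0. *)
have Re0 := @cvg_Re _ _ (nbhs_filter (0 : C)) id 0 cvg_id.
have Im0 := @cvg_Im _ _ (nbhs_filter (0 : C)) id 0 cvg_id.
have /(_ d d0) := @is_derive0_littleo expR _ (is_derive_expR 0).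
rewrite expR0 => /Re0 hE.
have /(_ d d0) := @is_derive0_littleo cos _ (is_derive_cos 0).
rewrite cos0 sin0 => /Im0 hC.
have /(_ d d0) := @is_derive0_littleo sin _ (is_derive_sin 0).
rewrite cos0 sin0 => /Im0 hS.
have hn : \forall x \near (0 : R), `|x| <= d / 2.
  have /cvgrPdist_le/(_ (d / 2)) : (x : R) @[x --> 0] --> 0 by exact: cvg_id.
  by rewrite divr_gt0// => /(_ isT); apply: filterS => x; rewrite sub0r normrN.
near=> h; apply: le_trans (_ : (6 * d)%:C%C * `|h| <= _); last first.
  by rewrite ler_wpM2r// lecR.
have -> : h = (Re h +i* Im h)%C by case: (h).
apply: cexp_sub_le => //; first by near: h; exact: Re0 hn.
- have : `|expR (Re h) - 1 - 1 * Re h| <= d * `|Re h| by near: h; exact: hE.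
  by rewrite mul1r.
- have : `|cos (Im h) - 1 - (- 0) * Im h| <= d * `|Im h| by near: h; exact: hC.
  by rewrite oppr0 mul0r subr0.
- have : `|sin (Im h) - 0 - 1 * Im h| <= d * `|Im h| by near: h; exact: hS.
  by rewrite mul1r subr0.
Unshelve. all: by end_near. Qed.

Lemma cexp0 : cexp (0 : C) = 1.
Proof. by rewrite /cexp/= expR0 cos0 sin0 mulr1 mulr0. Qed.

(** * The principal logarithm and complex powers near 1 *)

(** This is the polar form: [sin (acos (x / r))] is [|y| / r], and the sign chosen in [carg]
    restores the sign of [y]. *)
Lemma cexp_clog (z : C) : z != 0 -> cexp (clog z) = z.
Proof.
case: z => x y z0; rewrite /clog /carg /cexp.
set r := Num.sqrt _.
have r2 : r ^+ 2 = x ^+ 2 + y ^+ 2 by rewrite sqr_sqrtr// addr_ge0// sqr_ge0.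
have r0 : 0 < r.
  rewrite sqrtr_gt0 lt0r addr_ge0 ?sqr_ge0// andbT.
  rewrite paddr_eq0 ?sqr_ge0// !sqrf_eq0.
  by apply: contra z0; case/andP => /eqP-> /eqP->.
have xr : -1 <= x / r <= 1.
  rewrite -ler_norml normrM normfV (gtr0_norm r0) ler_pdivrMr// mul1r.
  by rewrite -sqrtr_sqr ler_sqrt ?addr_ge0 ?sqr_ge0// lerDl sqr_ge0.
have sr : sin (acos (x / r)) = `|y| / r.
  rewrite sin_acos// -[RHS]ger0_norm ?divr_ge0 ?(ltW r0)// -sqrtr_sqr.
  congr Num.sqrt; rewrite !expr_div_n real_normK ?num_real// r2; field.
  by rewrite -r2 expf_neq0 ?gt_eqF.
rewrite lnK ?posrE//; case: ifPn => y0.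
  by rewrite acosK ?in_itv//= sr ger0_norm// !(mulrC r) !divfK ?gt_eqF.
rewrite cosN sinN acosK ?in_itv//= sr ltr0_norm ?ltNge// mulNr opprK.
by rewrite !(mulrC r) !divfK ?gt_eqF.
Qed.

(** One-sided continuity of [acos] at the endpoint 1: as [cos] decreases strictly on [[0, pi]],
    [cos d < u] forces [acos u < d]. *)
Lemma cvg_acos1 (T : Type) (F : set_system T) {FF : Filter F} (f : T -> R) :
  (\forall x \near F, f x <= 1) -> f x @[x --> F] --> (1 : R) ->
  acos (f x) @[x --> F] --> (0 : R).
Proof.
move=> f1 /cvgrPdist_lt fc; apply/cvgrPdist_le => e e0.
pose d := Num.min e pi.
have dpi : d \in `[0, pi].
  by rewrite in_itv/= le_min pi_ge0 ltW//= ge_min lexx orbT.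
have d0 : 0 < d by rewrite lt_min e0 pi_gt0.
have cd : 0 < 1 - cos d.
  rewrite subr_gt0 -cos0 ltr_cos// in_itv/= lexx pi_ge0//.
(* The cap 1 forces [f x > 0], which keeps [f x] in the domain of [acos]. *)
have c0 : 0 < Num.min (1 - cos d) 1 by rewrite lt_min cd ltr01.
near=> x.
have : `|1 - f x| < Num.min (1 - cos d) 1 by near: x; exact: fc.
have fx1 : f x <= 1 by near: x.
rewrite ger0_norm ?subr_ge0// lt_min => /andP[fd f0].
have fx : -1 <= f x <= 1 by rewrite fx1 andbT; lra.
have ax : acos (f x) \in `[0, pi] by rewrite in_itv/= acos_ge0// acos_lepi.
rewrite sub0r normrN ger0_norm ?acos_ge0//.
have : acos (f x) < d by rewrite -ltr_cos// acosK ?in_itv//; lra.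
by rewrite lt_min => /andP[/ltW].
Unshelve. all: by end_near. Qed.

Lemma cvg_clog1 : clog z @[z --> (1 : C)] --> (0 : C).
Proof.
have FF : Filter (nbhs (1 : C)) := nbhs_filter (1 : C).
have Re1 : Re z @[z --> (1 : C)] --> (1 : R) := @cvg_Re _ _ FF id 1 cvg_id.
have Im1 : Im z @[z --> (1 : C)] --> (0 : R) := @cvg_Im _ _ FF id 1 cvg_id.
pose r (z : C) := Num.sqrt (Re z ^+ 2 + Im z ^+ 2).
have r1 : r z @[z --> (1 : C)] --> (1 : R).
  rewrite -[X in _ --> X]sqrtr1; apply: continuous_cvg.
    exact: sqrt_continuous.
  rewrite -[X in _ --> X](_ : 1 ^+ 2 + 0 ^+ 2 = 1); last first.
    by rewrite expr1n expr0n addr0.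
  by apply: cvgD; apply: cvgM.
have a1 : acos (Re z / r z) @[z --> (1 : C)] --> (0 : R).
  apply: cvg_acos1; last first.
    by rewrite -[X in _ --> X]divr1; apply: cvgM => //; apply: cvgV.
  near=> z; have rz : 0 < r z by near: z; exact: (cvgr_gt _ r1).
  rewrite ler_pdivrMr// mul1r (le_trans (ler_norm _))//.
  by rewrite -sqrtr_sqr ler_sqrt ?addr_ge0 ?sqr_ge0// lerDl sqr_ge0.
apply: cvgC_ReIm.
  rewrite (_ : (fun z => _) = @ln R \o r); last by apply/funext => -[].
  rewrite [X in _ --> X](_ : _ = @ln R 1); last by rewrite ln1.
  by apply: continuous_cvg => //; apply: continuous_ln.
(* The sign jump of [carg] across the real axis is harmless: its absolute value is that of the
   [acos] term on both sides. *)
apply/cvgrPdist_le => e e0; move/cvgrPdist_le : a1 => /(_ e e0).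
apply: filterS => -[x y]; rewrite !sub0r !normrN /clog /carg/= /r/=.
by case: ifP => //; rewrite normrN.
Unshelve. all: by end_near. Qed.

(* The value 1 at [h = 0] makes [cexp_slope] continuous there, so that the limit
   can be composed with [w * clog p], which may vanish. *)
Definition cexp_slope (h : C) : C := if h == 0 then 1 else (cexp h - 1) / h.

Lemma cexp_slopeM h : cexp_slope h * h = cexp h - 1.
Proof.
rewrite /cexp_slope; case: eqVneq => [->|h0]; last by rewrite divfK.
by rewrite mulr0 cexp0 subrr.
Qed.

Lemma cvg_cexp_slope0 : cexp_slope h @[h --> (0 : C)] --> (1 : C).
Proof.
apply/(@cvgCP _ _ (nbhs_filter (0 : C))) => e e0.
apply: filterS (cexp_sub_littleo e0) => h; rewrite /cexp_slope.
have [_ _|h0] := eqVneq h 0; first by rewrite subrr normr0 lecR ltW.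
rewrite -ler_pdivrMr ?normr_gt0// -normf_div distrC.
by congr (is_true (`|_| <= _)); field.
Qed.

(** With [S = cexp_slope] and [L = clog p], the quotient equals [- w * (S (w * L) / S L)], and both
    slopes tend to 1. *)
Lemma cvg_cpow_slope1 (F : set_system C) {FF : Filter F} (w : C) :
  (p : C) @[p --> F] --> (1 : C) -> (\forall p \near F, p != 1) ->
  (1 - cpow p w) / (p - 1) @[p --> F] --> - w.
Proof.
move=> F1 F1'.
have L0 : clog p @[p --> F] --> (0 : C) by exact: (cvg_comp _ _ F1 cvg_clog1).
have wL0 : w * clog p @[p --> F] --> (0 : C) by exact: cvg_mul0.
have G0 (f : C -> C) : f p @[p --> F] --> (0 : C) ->
    cexp_slope (f p) @[p --> F] --> (1 : C).
  by move=> f0; exact: (cvg_comp _ _ f0 cvg_cexp_slope0).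
apply: cvg_trans (cvg_mul_ratio1 (w := - w) (G0 _ wL0) (G0 _ L0)).
apply: near_eq_cvg; near=> p.
have p1 : p != 1 by near: p.
have p0 : p != 0.
  (* [Re p] tends to 1, so it is eventually positive. *)
  near: p; have /cvg_Re/(cvgr_gt (1 : R))/(_ _ ltr01) := F1.
  by apply: filterS => p; case: eqVneq => // ->; rewrite ltxx.
have := cexp_slopeM (clog p); rewrite cexp_clog// => SL.
have SL0 : cexp_slope (clog p) * clog p != 0 by rewrite SL subr_eq0.
have [S0 l0] : cexp_slope (clog p) != 0 /\ clog p != 0.
  by move: SL0; rewrite mulf_eq0 => /norP[].
by rewrite /cpow -opprB -cexp_slopeM -SL; field; rewrite S0 l0.
Unshelve. all: by end_near. Qed.

End Complex.

Theorem theorem6p9 (R : realType) (l : nat) (X : scheme) (n : nat)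
    (a : 'I_n.+1 -> int) (s : R[i]) :
  (0 < l)%N ->
  counting_polynomial l X (\sum_(k < n.+1) a k *: 'X^k) ->
  (forall k : 'I_n.+1, s != k%:R) ->
  zeta_Fp l a p s * (p - 1) ^ card_F1 a @[p --> (1 : R[i])^'] --> zeta_F1 l a s.
Proof.
move=> l0 _ sk; pose w (k : 'I_n.+1) : R[i] := l%:R * (k%:R - s).
have wN k : - w k = l%:R * (s - k%:R) by rewrite /w; ring.
(* Nonzero limits of the factors are what allows exponents of either sign. *)
have w0 k : - w k != 0 by rewrite wN mulf_neq0 ?subr_eq0// pnatr_eq0 -lt0n.
have FF : Filter (1 : R[i])^' := dnbhs_filter (1 : R[i]).
have F1 : (p : R[i]) @[p --> (1 : R[i])^'] --> (1 : R[i]) by exact: cvg_within.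
have F1' : \forall p \near (1 : R[i])^', p != 1 by exact: withinT.
(* The punctured neighbourhood is abstracted to a filter [F] that tends to 1 and avoids 1. *)
move: ((1 : R[i])^') FF F1 F1' => F FF F1 F1'.
have lim : \prod_k ((1 - cpow p (w k)) / (p - 1)) ^ (- a k) @[p --> F]
    --> zeta_F1 l a s.
  rewrite /zeta_F1; under eq_bigr do rewrite -wN.
  apply: cvg_prod_exprz; first exact: w0.
  by move=> k; exact: cvg_cpow_slope1.
apply: cvg_trans lim; apply: near_eq_cvg; near=> p.
have p1 : p - 1 != 0 by rewrite subr_eq0; near: p.
(* Additivity of integer exponents requires the nonzero base [p1], since some [a k] may be
   negative. *)
have -> : (p - 1) ^ card_F1 a = \prod_k (p - 1) ^ a k.
  rewrite /card_F1; elim/big_rec2: _ => [|k x z _ <-]; first by rewrite expr0z.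
  by rewrite expfzDr.
rewrite /zeta_Fp -big_split/=; apply: eq_bigr => k _.
rewrite expfzMl; congr (_ * _).
by rewrite -exprz_inv invrK.
Unshelve. all: by end_near. Qed.
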